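(* Let $G$ be a graph in $\Lambda_2$, i.e. a connected graph with at most two trivial distance ideals over $\mathbb{Z}$. Then $G$ is $\{F,\text{odd-holes}\}$-free; that is, no induced subgraph of $G$ is isomorphic to a graph in the family $F$, and no induced subgraph of $G$ is isomorphic to a cycle $C_m$ with $m$ odd and $m\geq 7$.
   Context: All graphs are finite, simple and connected. For a connected graph $G$ with vertex set $V(G)$ of size $n$, $d_G(u,v)$ is the number of edges of a shortest path between $u$ and $v$; $X_G=\{x_u : u\in V(G)\}$ is a set of indeterminates; the generalized distance matrix $D(G,X_G)$ is the $n\times n$ matrix over $\mathbb{Z}[X_G]$, indexed by $V(G)$, with $uu$-entry $x_u$ and $uv$-entry $d_G(u,v)$ for $u\neq v$. For $1\leq i\leq n$, the $i$-th distance ideal $I_i(G,X_G)$ is the ideal of $\mathbb{Z}[X_G]$ generated by the determinants of all $i\times i$ submatrices of $D(G,X_G)$ (any choice of $i$ rows and $i$ columns). An ideal is trivial if it equals $\langle 1\rangle$. $\Lambda_2$ is the family of connected graphs having at most two trivial distance ideals (over $\mathbb{Z}$). In this paper an odd-hole is a cycle of odd length at least $7$. $F$ is the set of the following graphs (given by vertex set and edge list, $ij$ denoting the edge between $i$ and $j$). On vertices $\{0,1,2,3,4\}$: bull: $04,13,23,24,34$; dart: $04,13,14,23,24,34$; house: $01,04,13,23,24,34$; gem: $03,04,12,14,23,24,34$; full-house: $03,04,12,13,14,23,24,34$. On vertices $\{0,1,2,3,4,5\}$: $G_{6,5}$: $04,15,23,25,35,45$; 5-pan: $05,12,14,23,35,45$;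 $G_{6,7}$: $04,12,15,25,34,35$; $G_{6,8}$: $05,14,15,23,25,35,45$; $G_{6,9}$: $05,15,23,24,34,35,45$; $G_{6,10}$: $01,05,14,24,25,34,35$; co-twin-house: $05,14,23,24,25,34,35$; $G_{6,12}$: $05,14,15,23,24,25,34,35$; co-twin-$C_5$: $01,05,14,23,24,25,34,35$; $G_{6,14}$: $02,03,04,05,12,13,14,15,24,25,34,35,45$. On vertices $\{0,1,2,3,4,5,6\}$: $G_{6,15}$: $01,06,16,24,25,34,35,46,56$. *)

(* Defs.v *)
From Stdlib Require List.
From mathcomp Require Import all_boot all_order all_algebra.
From mathcomp Require Import mpoly.

Set Implicit Arguments.
Unset Strict Implicit.
Unset Printing Implicit Defensive.

Import GRing.Theory.

Record sgraph := SGraph {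
  vertex :> finType;
  adj : rel vertex;
  adj_sym : ssrbool.symmetric adj;
  adj_irrefl : irreflexive adj }.

Definition connected (G : sgraph) : Prop :=
  forall u v : G, connect (@adj G) u v.

Section Induced.
Variables (G : sgraph) (S : {set G}).

Definition induced_adj : rel {x : G | x \in S} :=
  fun x y => adj (val x) (val y).

Fact induced_sym : ssrbool.symmetric induced_adj.
Proof. by move=> x y; apply: adj_sym. Qed.

Fact induced_irrefl : irreflexive induced_adj.
Proof. by move=> x; apply: adj_irrefl. Qed.

Definition induced : sgraph := SGraph induced_sym induced_irrefl.

End Induced.

Definition isomorphic (G H : sgraph) : Prop :=
  exists2 f : G -> H, bijective f & forall x y, adj (f x) (f y) = adj x y.

Definition free_of (G H : sgraph) : Prop :=
  forall S : {set G}, ~ isomorphic (induced S) H.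

(* The default value of [find] is #|G|, so that is the distance between two
   vertices in different components; a path in G has fewer than #|G| edges. *)
Definition dist (G : sgraph) (u v : G) : nat :=
  find (fun k => [exists p : k.-tuple G,
                    [&& path (@adj G) u p, uniq (u :: p) & last u p == v]])
       (iota 0 #|G|).

Section DistanceIdeals.
Local Open Scope ring_scope.

Section Ideal.
Variable R : comNzRingType.

Definition ideal_gen (A : R -> Prop) (p : R) : Prop :=
  exists2 s : seq (R * R),
    (forall x, x \in s -> A x.2) & p = \sum_(x <- s) x.1 * x.2.

Definition trivial_ideal (I : R -> Prop) : Prop :=
  forall p, I p <-> ideal_gen (fun g => g = 1) p.

End Ideal.

Variable G : sgraph.

(* The vertices are numbered by [enum_rank], and the indeterminate x_u is
   'X_(enum_rank u). *)
Definition dist_mx : 'M[{mpoly int[#|G|]}]_#|G| :=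
  \matrix_(i, j)
    if i == j then 'X_i else (dist (enum_val i) (enum_val j))%:R.

(* The rows and the columns of a submatrix may come in any order; this changes
   minors only by a sign, hence does not affect the ideal. *)
Definition minor_of (i : nat) (g : {mpoly int[#|G|]}) : Prop :=
  exists r c : 'I_i -> 'I_#|G|,
    [/\ injective r, injective c & g = \det (mxsub r c dist_mx)].

Definition distance_ideal (i : nat) : {mpoly int[#|G|]} -> Prop :=
  ideal_gen (minor_of i).

(* The ordinal i stands for the distance ideal of index i.+1, so the indices
   range over 1, ..., #|G|. *)
Definition at_most_trivial (k : nat) : Prop :=
  forall S : {set 'I_#|G|},
    (forall i, i \in S -> trivial_ideal (distance_ideal i.+1)) ->
    (#|S| <= k)%N.

Definition Lambda (k : nat) : Prop := connected G /\ at_most_trivial k.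

End DistanceIdeals.

Section EdgeList.
Variables (n : nat) (s : seq (nat * nat)).

Definition edge_adj : rel 'I_n := fun i j =>
  (i != j) && (((val i, val j) \in s) || ((val j, val i) \in s)).

Fact edge_sym : ssrbool.symmetric edge_adj.
Proof. by move=> i j; rewrite /edge_adj eq_sym orbC. Qed.

Fact edge_irrefl : irreflexive edge_adj.
Proof. by move=> i; rewrite /edge_adj eqxx. Qed.

Definition edge_graph : sgraph := SGraph edge_sym edge_irrefl.

End EdgeList.

Section Cycle.
Variable m : nat.

Definition cycle_adj : rel 'I_m := fun i j =>
  (i != j) && ((j == i.+1 %% m :> nat) || (i == j.+1 %% m :> nat)).

Fact cycle_sym : ssrbool.symmetric cycle_adj.
Proof. by move=> i j; rewrite /cycle_adj eq_sym orbC. Qed.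

Fact cycle_irrefl : irreflexive cycle_adj.
Proof. by move=> i; rewrite /cycle_adj eqxx. Qed.

Definition cycle_graph : sgraph := SGraph cycle_sym cycle_irrefl.

End Cycle.

Definition bull : sgraph := edge_graph 5
  [:: (0, 4); (1, 3); (2, 3); (2, 4); (3, 4)].

Definition dart : sgraph := edge_graph 5
  [:: (0, 4); (1, 3); (1, 4); (2, 3); (2, 4); (3, 4)].

Definition house : sgraph := edge_graph 5
  [:: (0, 1); (0, 4); (1, 3); (2, 3); (2, 4); (3, 4)].

Definition gem : sgraph := edge_graph 5
  [:: (0, 3); (0, 4); (1, 2); (1, 4); (2, 3); (2, 4); (3, 4)].

Definition full_house : sgraph := edge_graph 5
  [:: (0, 3); (0, 4); (1, 2); (1, 3); (1, 4); (2, 3); (2, 4);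
      (3, 4)].

Definition G_6_5 : sgraph := edge_graph 6
  [:: (0, 4); (1, 5); (2, 3); (2, 5); (3, 5); (4, 5)].

Definition pan5 : sgraph := edge_graph 6
  [:: (0, 5); (1, 2); (1, 4); (2, 3); (3, 5); (4, 5)].

Definition G_6_7 : sgraph := edge_graph 6
  [:: (0, 4); (1, 2); (1, 5); (2, 5); (3, 4); (3, 5)].

Definition G_6_8 : sgraph := edge_graph 6
  [:: (0, 5); (1, 4); (1, 5); (2, 3); (2, 5); (3, 5); (4, 5)].

Definition G_6_9 : sgraph := edge_graph 6
  [:: (0, 5); (1, 5); (2, 3); (2, 4); (3, 4); (3, 5); (4, 5)].

Definition G_6_10 : sgraph := edge_graph 6
  [:: (0, 1); (0, 5); (1, 4); (2, 4); (2, 5); (3, 4); (3, 5)].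

Definition co_twin_house : sgraph := edge_graph 6
  [:: (0, 5); (1, 4); (2, 3); (2, 4); (2, 5); (3, 4); (3, 5)].

Definition G_6_12 : sgraph := edge_graph 6
  [:: (0, 5); (1, 4); (1, 5); (2, 3); (2, 4); (2, 5); (3, 4);
      (3, 5)].

Definition co_twin_C5 : sgraph := edge_graph 6
  [:: (0, 1); (0, 5); (1, 4); (2, 3); (2, 4); (2, 5); (3, 4);
      (3, 5)].

Definition G_6_14 : sgraph := edge_graph 6
  [:: (0, 2); (0, 3); (0, 4); (0, 5); (1, 2); (1, 3); (1, 4);
      (1, 5); (2, 4); (2, 5); (3, 4); (3, 5); (4, 5)].

Definition G_6_15 : sgraph := edge_graph 7
  [:: (0, 1); (0, 6); (1, 6); (2, 4); (2, 5); (3, 4); (3, 5);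
      (4, 6); (5, 6)].

Definition family_F : seq sgraph :=
  [:: bull; dart; house; gem; full_house;
      G_6_5; pan5; G_6_7; G_6_8; G_6_9; G_6_10; co_twin_house;
      G_6_12; co_twin_C5; G_6_14;
      G_6_15].

(* Main.v *)
Require Import Defs.
From Stdlib Require List.
From mathcomp Require Import all_boot all_order all_algebra.
From mathcomp Require Import mpoly.
From mathcomp Require Import zify ring.

Set Implicit Arguments.
Unset Strict Implicit.
Unset Printing Implicit Defensive.

Import GRing.Theory.

(** By Laplace expansion the distance ideals decrease, so if the third one
    contained 1 then the first three would all be trivial.  For G in Lambda_2
    the third distance ideal I is therefore proper, and it is enough to show
    that a forbidden induced subgraph puts 1 into I.

    Distances in an induced subgraph H may shrink when they are measured in G,
    so the distance matrix of H itself is of no use.  All that is known of the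
    distances of G between the vertices of H is that they form an integral
    metric whose pairs at distance 1 are the edges of H.  There are few such
    metrics, and each of them is treated as follows.

    A 3 x 3 minor whose rows and columns share a single vertex v has the form
    alpha x_v + beta with integers alpha and beta.  Eliminating x_v between
    these linear forms with Euclid's algorithm leaves integers that belong to
    I ([eliminate_sound]); their gcd over all v is the obstruction of the
    metric ([obstruction_sound]).  If it is 1, the metric is impossible.  A
    tree search that adds the vertices one at a time and prunes at obstruction
    1 kills every metric on every graph of the family, with two exceptions: on
    [G_6_7] and [co_twin_house] some metrics have a matrix that can be completed
    to rank 2 modulo 2 or modulo 3 by a choice of the diagonal.  They assign to
    the vertices 0 and 1 a distance smaller than the one in H, which must be
    realised by a path of G that leaves H; adding vertices on geodesics of G
    kills these metrics as well ([search_between]).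

    For an odd hole v_0, ..., v_(m-1) the same search on induced paths with six
    vertices shows that 4 belongs to I and that v_i and v_(i+3) are at distance
    3 ([induced_P6]).  An odd integer in I would then give 1.  The minor with
    rows v_j, v_(j+1), v_(j+4) and columns v_(j+2), v_(j+3), v_0 is an integer,
    and shows that d(v_j, v_0) and d(v_(j+4), v_0) have the same parity.  From
    d(v_2, v_0) = 2 it follows that d(v_j, v_0) is even for every j < m with
    j = 2 mod 4; but for m odd one of m - 1 and m - 3 is such a j, and there
    the distance is 1 or 3. *)

(** * The distance of a connected graph *)

Section Metric.
Variable G : sgraph.
Hypothesis connG : connected G.
Implicit Types u v w : G.

Lemma dist_le_size u p : path (@adj G) u p -> dist u (last u p) <= size p.
Proof.
case/shortenP=> q path_q uniq_q sub_qp.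
have le_qp : size q <= size p by apply: uniq_leq_size => //; case/andP: uniq_q.
have lt_q : size q < #|G|.
  by rewrite cardE (@uniq_leq_size _ (u :: q)) // => w; rewrite mem_enum.
apply: leq_trans le_qp; rewrite leqNgt; apply/negP => /(before_find 0).
rewrite nth_iota // add0n => /negbT/existsP; apply.
by exists (in_tuple q); rewrite path_q uniq_q eqxx.
Qed.

Lemma geodesic u v :
  exists p, [/\ path (@adj G) u p, last u p = v & size p = dist u v].
Proof.
have /connectP[p0 path_p0 ->] := connG u v.
case: (shortenP path_p0) => p path_p uniq_p _.
have lt_p : size p < #|G|.
  by rewrite cardE (@uniq_leq_size _ (u :: p)) // => w; rewrite mem_enum.
pose a k := [exists q : k.-tuple G,
               [&& path (@adj G) u q, uniq (u :: q) & last u q == last u p]].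
have a_p : a (size p).
  by apply/existsP; exists (in_tuple p); rewrite path_p uniq_p eqxx.
have has_a : has a (iota 0 #|G|).
  by apply/hasP; exists (size p); rewrite ?mem_iota.
have /existsP[q /and3P[path_q _ /eqP last_q]] := nth_find 0 has_a.
exists q; split=> //; rewrite size_tuple nth_iota //.
by rewrite -[X in _ < X](size_iota 0) -has_find; apply: has_a.
Qed.

Lemma dist_eq0 u v : (dist u v == 0) = (u == v).
Proof.
apply/eqP/eqP => [d0 | <-].
  have [[|w p] [_ last_p]] := geodesic u v; first by [].
  by rewrite d0.
by apply/eqP; rewrite -leqn0 (@dist_le_size u [::]).
Qed.

Lemma dist_eq1 u v : (dist u v == 1) = adj u v.
Proof.
apply/eqP/idP => [d1 | uv].
  have [[|w [|? ?]] [//= path_p last_p]] := geodesic u v; rewrite d1 // => _.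
  by move: path_p; rewrite -last_p /= andbT.
apply/eqP; rewrite eqn_leq (@dist_le_size u [:: v]) /= ?uv // lt0n dist_eq0.
by apply: contraTneq uv => ->; rewrite adj_irrefl.
Qed.

Lemma dist_triangle u v w : dist u w <= dist u v + dist v w.
Proof.
have [p [path_p last_p <-]] := geodesic u v.
have [q [path_q last_q <-]] := geodesic v w.
rewrite -size_cat -last_q -last_p -last_cat; apply: dist_le_size.
by rewrite cat_path path_p last_p.
Qed.

Lemma dist_sym u v : dist u v = dist v u.
Proof.
suff le u' v' : dist u' v' <= dist v' u' by apply/eqP; rewrite eqn_leq !le.
have [p [path_p last_p <-]] := geodesic v' u'.
have := @dist_le_size (last v' p) (rev (belast v' p)).
rewrite size_rev size_belast rev_path last_p.
rewrite (eq_path (e' := @adj G)) => [/(_ path_p)|x y]; last exact: adj_sym.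
by rewrite -last_p; case: p {path_p last_p} => //= x p; rewrite rev_cons last_rcons.
Qed.

Lemma geodesic_step u v :
  0 < dist u v -> exists2 w, dist w u = 1 & dist w v = (dist u v).-1.
Proof.
have [p [path_p last_p size_p]] := geodesic u v; rewrite -size_p.
case: p path_p last_p size_p => //= w p /andP[uw path_p] last_p size_p _.
exists w; first by apply/eqP; rewrite dist_eq1 adj_sym.
apply/eqP; rewrite eqn_leq -{1}last_p dist_le_size //= -ltnS size_p.
by have := dist_triangle u w v; move: uw; rewrite -dist_eq1 => /eqP->.
Qed.

End Metric.

(** * Ideals given by generators *)

Section IdealGen.
Local Open Scope ring_scope.
Variables (R : comNzRingType) (A : R -> Prop).
Local Notation I := (ideal_gen A).

Lemma mem_ideal_gen g : A g -> I g.
Proof.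
by move=> Ag; exists [:: (1, g)] => [x /[!inE] /eqP-> //|]; rewrite big_seq1 mul1r.
Qed.

Lemma ideal_gen0 : I 0.
Proof. by exists [::]; rewrite ?big_nil. Qed.

Lemma ideal_genD p q : I p -> I q -> I (p + q).
Proof.
case=> s As -> [t At ->]; exists (s ++ t); last by rewrite big_cat.
by move=> x; rewrite mem_cat => /orP[/As | /At].
Qed.

Lemma ideal_genMl c p : I p -> I (c * p).
Proof.
case=> s As ->; exists [seq (c * x.1, x.2) | x <- s].
  by move=> x /mapP[y /As Ay ->].
by rewrite big_map mulr_sumr; apply: eq_bigr => x _; rewrite mulrA.
Qed.

Lemma ideal_gen_sum (J : Type) (r : seq J) (F : J -> R) :
  (forall j, I (F j)) -> I (\sum_(j <- r) F j).
Proof.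
by move=> IF; apply: big_rec => [|j p _]; [exact: ideal_gen0 | exact: ideal_genD].
Qed.

Lemma ideal_gen_gcd (m n : int) : I m%:~R -> I n%:~R -> I (gcdn `|m| `|n|)%:R.
Proof.
move=> Im In; have [u [v uv]] := Bezoutz m n.
rewrite -[_%:R]/((gcdz m n)%:~R) -uv intrD !intrM.
by apply: ideal_genD; apply: ideal_genMl.
Qed.

Lemma trivial_ideal1 : I 1 -> trivial_ideal I.
Proof.
move=> I1 p; split=> _; last by rewrite -[p]mulr1; apply: ideal_genMl.
by exists [:: (p, 1)] => [x /[!inE] /eqP-> //|]; rewrite big_seq1 mulr1.
Qed.

End IdealGen.

Lemma ideal_gen_trans (R : comNzRingType) (A B : R -> Prop) p :
  (forall g, A g -> ideal_gen B g) -> ideal_gen A p -> ideal_gen B p.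
Proof.
move=> AB [s As ->]; rewrite big_seq.
apply: big_rec => [|x q /As/AB Bx Bq]; first exact: ideal_gen0.
by apply: ideal_genD Bq; apply: ideal_genMl.
Qed.

(** * Minors of the distance matrix *)

Section DistanceIdeals.
Local Open Scope ring_scope.

(** The index type is arbitrary, so that minors can be formed on the vertices
    themselves as well as on their ranks. *)
Definition det3 (T : Type) (R : pzRingType) (m : T -> T -> R) a b c a' b' c' :=
  m a a' * (m b b' * m c c' - m b c' * m c b')
  - m a b' * (m b a' * m c c' - m b c' * m c a')
  + m a c' * (m b a' * m c b' - m b b' * m c a').

Lemma det_mxsub3 (R : comNzRingType) n (M : 'M[R]_n) (r c : 'I_3 -> 'I_n) :
  \det (mxsub r c M) = det3 M (r 0) (r 1) (r 2%:R) (c 0) (c 1) (c 2%:R).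
Proof.
rewrite (_ : det3 M _ _ _ _ _ _ = det3 (mxsub r c M) 0 1 2%:R 0 1 2%:R); last first.
  by rewrite /det3 !mxE.
(* Indexing by numbers makes the lifts in the Laplace expansion compute. *)
move: (mxsub r c M) => {M r c}N; pose f a b := N (inord a) (inord b).
have Nf i j : N i j = f i j by rewrite /f !inord_val.
rewrite (expand_det_row _ 0) !big_ord_recl big_ord0.
rewrite /cofactor !(expand_det_row _ 0) !big_ord_recl !big_ord0 /cofactor.
by rewrite !det_mx11 !mxE /det3 !Nf /= /bump /=; ring.
Qed.

Variable G : sgraph.

(** Laplace expansion along a row. *)
Lemma distance_idealS i p : @distance_ideal G i.+2 p -> @distance_ideal G i.+1 p.
Proof.
apply: ideal_gen_trans => g [r [c [injr injc ->]]].
rewrite (expand_det_row _ ord0); apply: ideal_gen_sum => j; apply: ideal_genMl.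
rewrite /cofactor; apply/ideal_genMl/mem_ideal_gen.
exists (r \o lift ord0), (c \o lift j); split.
- exact: inj_comp injr (@lift_inj _ _).
- exact: inj_comp injc (@lift_inj _ _).
- by congr (\det _); apply/matrixP => a b; rewrite !mxE.
Qed.

Lemma Lambda2_proper : (2 < #|G|)%N -> Lambda G 2 -> ~ @distance_ideal G 3 1.
Proof.
move=> G3 [_ /(_ [set i : 'I_#|G| | (i < 3)%N])triv] I3.
have I2 := distance_idealS I3; have I1 := distance_idealS I2.
have /triv : forall i, i \in [set i : 'I_#|G| | (i < 3)%N] ->
    trivial_ideal (@distance_ideal G i.+1).
  by move=> [[|[|[|i]]] lti] //; rewrite inE // => _; apply: trivial_ideal1.
rewrite leqNgt => /negP; apply.
have injw : injective (widen_ord G3) by move=> i j [] /val_inj.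
rewrite -[X in (X <= _)%N](card_ord 3) -(card_imset _ injw).
by apply/subset_leq_card/subsetP => _ /imsetP[i _ ->]; rewrite inE /=.
Qed.

Definition dentry (u v : G) : {mpoly int[#|G|]} :=
  @dist_mx G (enum_rank u) (enum_rank v).

Lemma dentry_neq u v : u != v -> dentry u v = (dist u v)%:R.
Proof.
by move=> uv; rewrite /dentry mxE (inj_eq enum_rank_inj) (negbTE uv) !enum_rankK.
Qed.

Lemma det3_in_ideal a b c a' b' c' :
  uniq [:: a; b; c] -> uniq [:: a'; b'; c'] ->
  @distance_ideal G 3 (det3 dentry a b c a' b' c').
Proof.
move=> uniq_r uniq_c; apply: mem_ideal_gen.
have inj (t : 3.-tuple G) : uniq t -> injective (enum_rank \o tnth t).
  by move=> Ut; apply: inj_comp; [exact: enum_rank_inj | apply/tuple_uniqP].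
exists (enum_rank \o tnth [tuple a; b; c]), (enum_rank \o tnth [tuple a'; b'; c']).
by split; [exact: inj uniq_r | exact: inj uniq_c | rewrite det_mxsub3].
Qed.

End DistanceIdeals.

(** * Elimination of a diagonal variable *)

Section Elimination.
Local Open Scope ring_scope.

(** A pair (alpha, beta) stands for the linear form alpha x + beta.  Euclid's
    algorithm on the leading coefficients turns two forms into one form and a
    constant, without changing the ideal that they generate. *)
Fixpoint euclid (fuel : nat) (e f : int * int) : (int * int) * int :=
  if fuel is fuel'.+1 then
    if f.1 == 0 then (e, f.2)
    else let q := (e.1 %/ f.1)%Z in euclid fuel' f (e.1 - q * f.1, e.2 - q * f.2)
  else (e, 0).

(** The gcd of the constants met while the forms of s are combined into a
    single one.  The remainders decrease, so the fuel is never exhausted. *)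
Definition eliminate (s : seq (int * int)) : nat :=
  (foldr (fun f st => let r := euclid `|f.1|.+1 st.1 f in (r.1, gcdn `|r.2| st.2))
    ((0, 0), 0%N) s).2.

Variables (R : comNzRingType) (A : R -> Prop) (x : R).
Local Notation I := (ideal_gen A).

Definition vanishes (e : int * int) : Prop := I (e.1%:~R * x + e.2%:~R).

Lemma euclid_sound fuel e f :
  vanishes e -> vanishes f ->
  vanishes (euclid fuel e f).1 /\ I (euclid fuel e f).2%:~R.
Proof.
elim: fuel e f => [|fuel IH] e f Ie If /=; first by split=> //; apply: ideal_gen0.
case: eqP => [f0 | _] /=; first by split=> //; move: If; rewrite /vanishes f0 mul0r add0r.
apply: IH => //; rewrite /vanishes /= !intrD !intrN !intrM.
have := ideal_genD Ie (ideal_genMl (- (e.1 %/ f.1)%Z%:~R) If).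
by congr I; ring.
Qed.

Lemma eliminate_sound s : (forall e, e \in s -> vanishes e) -> I (eliminate s)%:R.
Proof.
rewrite /eliminate => Is.
set st := foldr _ _ _; suff: vanishes st.1 /\ I st.2%:R by case.
rewrite {}/st; elim: s Is => [|f s IH] Is /=.
  by split; rewrite ?/vanishes ?mul0r ?addr0; apply: ideal_gen0.
have [|Ie Ig] := IH; first by move=> e se; apply: Is; rewrite inE se orbT.
have [|Ir Ic] := euclid_sound `|f.1|.+1 Ie (Is f _); first by rewrite inE eqxx.
split=> //; rewrite -[X in gcdn _ X]absz_nat.
exact: ideal_gen_gcd.
Qed.

End Elimination.

(** * The obstruction of a metric *)

Fixpoint pairs (s : seq nat) : seq (nat * nat) :=
  if s is i :: s' then [seq (i, j) | j <- s'] ++ pairs s' else [::].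

Lemma mem_pairs s p :
  uniq s -> p \in pairs s -> [/\ p.1 \in s, p.2 \in s & p.1 != p.2].
Proof.
elim: s => //= i s IH /andP[nsi Us].
rewrite mem_cat => /orP[/mapP[j sj ->]|sp] /=.
  by rewrite !inE eqxx sj orbT; split=> //; apply: contraNneq nsi => ->.
by have [p1 p2 p12] := IH Us sp; rewrite !inE p1 p2 !orbT.
Qed.

(** A finite metric is stored as the upper triangle of its matrix: row k lists
    the distances from point k to the points k + 1, k + 2, ...; a new point is
    put in front. *)
Definition entry (M : seq (seq nat)) (i j : nat) : nat :=
  if i < j then nth 0 (nth [::] M i) (j - i.+1)
  else nth 0 (nth [::] M j) (i - j.+1).

(** The minor with rows p.1, p.2, v and columns q.1, q.2, v, as a linear form in
    its entry at (v, v). *)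
Definition equation (m : nat -> nat -> int) (v : nat) (p q : nat * nat) : int * int :=
  (m p.1 q.1 * m p.2 q.2 - m p.1 q.2 * m p.2 q.1,
   m p.1 v * (m p.2 q.1 * m v q.2 - m p.2 q.2 * m v q.1) -
   m p.2 v * (m p.1 q.1 * m v q.2 - m p.1 q.2 * m v q.1))%R.

Definition equations (M : seq (seq nat)) (v : nat) : seq (int * int) :=
  let s := rem v (iota 0 (size M)) in
  [seq equation (fun i j => Posz (entry M i j)) v p q
     | p <- pairs s, q <- pairs (rem p.1 (rem p.2 s))].

Definition obstruction (M : seq (seq nat)) : nat :=
  foldr (fun v g => gcdn (eliminate (equations M v)) g) 0 (iota 0 (size M)).

Section Obstruction.
Variable G : sgraph.
Hypothesis connG : connected G.

Fixpoint dists (vs : seq G) : seq (seq nat) :=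
  if vs is v :: vs' then [seq dist v u | u <- vs'] :: dists vs' else [::].

Lemma size_dists vs : size (dists vs) = size vs.
Proof. by elim: vs => //= v vs ->. Qed.

Lemma entry_dists u0 vs i j : i < size vs -> j < size vs -> i != j ->
  entry (dists vs) i j = dist (nth u0 vs i) (nth u0 vs j).
Proof.
have lt_case k l : k < l -> l < size vs ->
    nth 0 (nth [::] (dists vs) k) (l - k.+1) = dist (nth u0 vs k) (nth u0 vs l).
  elim: vs k l => //= v vs IH [|k] [|l] //= lt_kl lt_l; last exact: IH.
  by rewrite subn1 (nth_map u0).
rewrite /entry; case: (ltngtP i j) => // [ij _ j_lt _|ji i_lt _ _]; first exact: lt_case.
by rewrite (dist_sym connG) lt_case.
Qed.

Lemma equation_sound u0 vs v p q :
    uniq vs -> uniq [:: v; p.1; p.2; q.1; q.2] ->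
    all (gtn (size vs)) [:: v; p.1; p.2; q.1; q.2] ->
  vanishes (@minor_of G 3) (dentry (nth u0 vs v) (nth u0 vs v))
    (equation (fun i j => Posz (entry (dists vs) i j)) v p q).
Proof.
case: p q => [a b] [c e] Uvs Uidx /= /and5P[v_lt a_lt b_lt c_lt /andP[e_lt _]].
pose w := nth u0 vs; pose m i j := Posz (entry (dists vs) i j).
have nthI i j : i < size vs -> j < size vs -> (w i == w j) = (i == j).
  by move=> i_lt j_lt; rewrite nth_uniq.
have mE i j : i < size vs -> j < size vs -> i != j ->
    dentry (w i) (w j) = (m i j)%:~R%R.
  by move=> i_lt j_lt ij; rewrite dentry_neq ?nthI // /m (entry_dists u0).
have := @det3_in_ideal G (w a) (w b) (w v) (w c) (w e) (w v).
move: Uidx; rewrite /= !inE !negb_or !nthI //.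
case/and5P=> /and4P[va vb vc ve] /and3P[ab ac ae] /andP[bc be] ce _.
rewrite ab ce ![_ == v]eq_sym va vb vc ve => /(_ isT isT).
rewrite /det3 /vanishes /equation /= -/w; set x := dentry (w v) (w v).
rewrite !mE; try by rewrite // eq_sym.
by rewrite !(intrD, intrN, intrM) -/(m _ _); congr (ideal_gen _ _); ring.
Qed.

Lemma obstruction_sound vs :
  uniq vs -> @distance_ideal G 3 (obstruction (dists vs))%:R%R.
Proof.
case: vs => [_|u0 vs0]; first by apply: ideal_gen0.
move: (u0 :: vs0) => vs Uvs; rewrite /obstruction size_dists.
have: all (gtn (size vs)) (iota 0 (size vs)) by apply/allP=> i; rewrite mem_iota.
elim: {1 2}(iota _ _) => /= [_|v s IH /andP[v_lt s_lt]]; first exact: ideal_gen0.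
apply: (@ideal_gen_gcd _ _ (Posz _) (Posz _)); last exact: IH.
apply: (@eliminate_sound _ _ (dentry (nth u0 vs v) (nth u0 vs v))) => e.
have Us : uniq (rem v (iota 0 (size vs))) by rewrite rem_uniq ?iota_uniq.
rewrite /equations size_dists.
case/allpairsPdep=> p [q [/(mem_pairs Us)[p1 p2 p12] /mem_pairs[|q1 q2 q12 ->]]].
  by do 2!apply: rem_uniq.
have mem_v i : (i \in rem v (iota 0 (size vs))) = (i != v) && (i < size vs).
  by rewrite mem_rem_uniq ?iota_uniq // !inE mem_iota.
have Up : uniq (rem p.2 (rem v (iota 0 (size vs)))) by apply: rem_uniq.
move: q1 q2 p1 p2.
rewrite !(mem_rem_uniq _ Up) !inE !(mem_rem_uniq _ Us) !inE !mem_v.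
move=> + + /andP[p1v p1] /andP[p2v p2].
case/and4P=> q1p1 q1p2 q1v q1 /and4P[q2p1 q2p2 q2v q2].
apply: equation_sound => //=; last by rewrite v_lt p1 p2 q1 q2.
rewrite !inE !negb_or p12 q12 ![v == _]eq_sym p1v p2v q1v q2v.
by rewrite ![p.1 == _]eq_sym ![p.2 == _]eq_sym q1p1 q1p2 q2p1 q2p2.
Qed.

End Obstruction.

(** * Search through the metrics *)

Definition triangle a b c := [&& a <= b + c, b <= a + c & c <= a + b].

(** The positive distances, at most n, from a new point to the points of M that
    satisfy the constraints ps pointwise and the triangle inequalities. *)
Fixpoint new_rows (n : nat) (M : seq (seq nat)) (ps : seq (pred nat)) :
    seq (seq nat) :=
  if M is r :: M' then
    if ps is p :: ps' then
      [seq a :: t | t <- new_rows n M' ps',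
                    a <- [seq a <- iota 1 n | p a && all2 (triangle a) t r]]
    else [:: [::]]
  else [:: [::]].

(** [Attach r] adds a vertex whose adjacency to the points present is r;
    [Between i j] adds the neighbour of point i on a geodesic to point j. *)
Inductive step := Attach of seq bool | Between of nat & nat.

(** Strictly larger than every distance in M, hence a bound for the distances
    from any new point that is adjacent to a point of M. *)
Definition top (M : seq (seq nat)) : nat := (foldr maxn 0 (flatten M)).+1.

(** A vertex to be attached must have a neighbour, for [top] to bound its
    distances, and a vertex on a geodesic must not be among the points present,
    for the vertices to remain distinct. *)
Definition step_ok (M : seq (seq nat)) (st : step) : bool :=
  match st with
  | Attach r => nilp r || has id r
  | Between i j =>
      [&& i < size M, j < size M, i != j, 1 < entry M i j &
          ~~ has (fun l => (entry M i l == 1) && (entry M l j == (entry M i j).-1))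
                 (iota 0 (size M))]
  end.

Definition step_preds (M : seq (seq nat)) (st : step) : seq (pred nat) :=
  match st with
  | Attach r => [seq (fun a => (a == 1) == b) | b <- r]
  | Between i j =>
      mkseq (fun k a => if k == i then a == 1
                        else if k == j then a == (entry M i j).-1 else true)
            (size M)
  end.

(** A branch is closed when its obstruction is 1, for then no proper ideal
    contains the minors; the metrics at the end of open branches must satisfy
    [leaf]. *)
Fixpoint search (leaf : pred (seq (seq nat))) (M : seq (seq nat)) (s : seq step) : bool :=
  (* Call by value would explore all branches of a boolean connective. *)
  if obstruction M == 1 then true
  else if s is st :: s' then
    if step_ok M st
    then all (fun t => search leaf (t :: M) s') (new_rows (top M) M (step_preds M st))
    else false
  else leaf M.

Fixpoint attach_steps (e : rel nat) (done s : seq nat) : seq step :=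
  if s is x :: s' then Attach [seq e x y | y <- done] :: attach_steps e (x :: done) s'
  else [::].

Section Search.
Variable G : sgraph.
Hypothesis connG : connected G.
Hypothesis proper3 : ~ @distance_ideal G 3 1%R.
Variable leaf : pred (seq (seq nat)).
Implicit Types (vs : seq G) (u v w : G).

Lemma dist_lt_top vs u v : u \in vs -> v \in vs -> dist u v < top (dists vs).
Proof.
have le_max s (n : nat) : n \in s -> n <= foldr maxn 0 s.
  elim: s => //= m s IH.
  by rewrite inE leq_max => /predU1P[-> | /IH->]; rewrite ?leqnn ?orbT.
have [<- _ _|] := eqVneq u v; first by rewrite (eqP (_ : dist u u == 0)) ?dist_eq0.
move=> uv u_vs v_vs; apply: le_max; elim: vs u_vs v_vs => //= w vs IH.
rewrite !inE mem_cat => /predU1P[uw|u_vs] /predU1P[vw|v_vs].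
- by rewrite uw vw eqxx in uv.
- by rewrite uw map_f.
- by rewrite vw (dist_sym connG) map_f.
- by rewrite IH ?orbT.
Qed.

Lemma dist_le_top vs v u w :
  w \in vs -> dist v w = 1 -> u \in vs -> dist v u <= top (dists vs).
Proof.
move=> w_vs vw1 u_vs; apply: leq_trans (dist_lt_top w_vs u_vs).
by rewrite -[(dist w u).+1]add1n -vw1 dist_triangle.
Qed.

Lemma mem_new_rows n vs v ps :
    v \notin vs -> (forall u, u \in vs -> dist v u <= n) ->
    all2 (fun p a => p a) ps [seq dist v u | u <- vs] ->
  [seq dist v u | u <- vs] \in new_rows n (dists vs) ps.
Proof.
elim: vs ps => [|w vs IH] [|p ps] //=; rewrite inE negb_or => /andP[vw v_vs] le_n.
case/andP=> p_w ps_vs; apply/allpairsPdep.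
exists [seq dist v u | u <- vs], (dist v w); split=> //.
  by apply: IH => // u u_vs; apply: le_n; rewrite inE u_vs orbT.
rewrite mem_filter p_w mem_iota add1n ltnS le_n ?mem_head //.
rewrite lt0n (dist_eq0 connG) vw !andbT /=.
elim: vs {IH ps_vs v_vs le_n} => //= u vs ->; rewrite andbT; apply/and3P; split.
- by rewrite (dist_sym connG w u) dist_triangle.
- exact: dist_triangle.
- by rewrite (dist_sym connG v w) dist_triangle.
Qed.

Lemma attach_row vs v (st := Attach [seq dist v u == 1 | u <- vs]) :
    v \notin vs -> step_ok (dists vs) st ->
  [seq dist v u | u <- vs]
    \in new_rows (top (dists vs)) (dists vs) (step_preds (dists vs) st).
Proof.
move=> v_vs ok; apply: mem_new_rows => // [u u_vs|].
  case/orP: ok => [/nilP/(congr1 size)|/hasP[_ /mapP[w w_vs ->] /eqP vw1]].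
    by rewrite size_map => /size0nil vs0; rewrite vs0 in u_vs.
  exact: dist_le_top w_vs vw1 u_vs.
by rewrite /st /=; elim: (vs) => //= u us ->; rewrite eqxx.
Qed.

Lemma searchP vs st s : uniq vs -> search leaf (dists vs) (st :: s) ->
  step_ok (dists vs) st /\
  {in new_rows (top (dists vs)) (dists vs) (step_preds (dists vs) st),
     forall t, search leaf (t :: dists vs) s}.
Proof.
move=> Uvs /=; case: eqP => [ob1 _ | _].
  by case: proper3; have := obstruction_sound connG Uvs; rewrite ob1.
by case: ifP => // _ /allP.
Qed.

Lemma search_nil vs : uniq vs -> search leaf (dists vs) [::] -> leaf (dists vs).
Proof.
move=> Uvs /=; case: eqP => [ob1 _ | _ //].
by case: proper3; have := obstruction_sound connG Uvs; rewrite ob1.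
Qed.

Lemma search_attach (e : rel nat) (f : nat -> G) done s rest :
    {in catrev s done &, forall i j, (f i == f j) = (i == j)} ->
    {in catrev s done &, forall i j, i != j -> adj (f i) (f j) = e i j} ->
    uniq (catrev s done) ->
    search leaf (dists (map f done)) (attach_steps e done s ++ rest) ->
  search leaf (dists (map f (catrev s done))) rest.
Proof.
elim: s done => // x s IH done injf adjf U.
rewrite [catrev _ _]/= in injf adjf U *.
have sub y : y \in x :: done -> y \in catrev s (x :: done).
  by rewrite catrevE mem_cat => ->; rewrite orbT.
have Ud : uniq (x :: done) by move: U; rewrite catrevE cat_uniq => /and3P[].
have x_in := sub x (mem_head _ _).
have sub' y : y \in done -> y \in catrev s (x :: done).
  by move=> y_in; apply: sub; rewrite inE y_in orbT.
have fx_notin : f x \notin map f done.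
  apply/mapP => -[y y_in /eqP]; rewrite (injf _ _ x_in (sub' _ y_in)) => /eqP xy.
  by move: Ud; rewrite /= xy y_in.
have Uf : uniq (map f done).
  rewrite map_inj_in_uniq; first by case/andP: Ud.
  by move=> i j i_in j_in /eqP; rewrite (injf _ _ (sub' _ i_in) (sub' _ j_in)) => /eqP.
have fxE : [seq dist (f x) u == 1 | u <- map f done] = [seq e x y | y <- done].
  rewrite -map_comp; apply/eq_in_map => y y_in /=.
  rewrite dist_eq1 // (adjf _ _ x_in (sub' _ y_in)) //.
  by apply: contraTneq Ud => ->; rewrite /= y_in.
rewrite [attach_steps _ _ _]/= cat_cons => /(searchP Uf)[ok all_rows]; apply: IH => //.
apply: (all_rows [seq dist (f x) u | u <- map f done]).
by rewrite -fxE attach_row // fxE.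
Qed.

(** If the vertices of s are embedded by f as an induced subgraph with adjacency
    e, one of the branches of the search carries the distances of G. *)
Lemma search_embedding (e : rel nat) (f : nat -> G) s rest :
    uniq s -> {in s &, forall i j, (f i == f j) = (i == j)} ->
    {in s &, forall i j, i != j -> adj (f i) (f j) = e i j} ->
    search leaf [::] (attach_steps e [::] s ++ rest) ->
  uniq (map f (rev s)) /\ search leaf (dists (map f (rev s))) rest.
Proof.
move=> Us injf adjf search_s; split.
  rewrite map_inj_in_uniq ?rev_uniq // => i j; rewrite !mem_rev => i_s j_s /eqP.
  by rewrite injf // => /eqP.
apply: (@search_attach e f [::]) => // [i j|i j|]; rewrite -/(rev s) ?mem_rev ?rev_uniq //.
  exact: injf.
exact: adjf.
Qed.

(** The branch is followed by a vertex that exists because distances of G are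
    realised by paths. *)
Lemma search_between vs i j s : uniq vs ->
    search leaf (dists vs) (Between i j :: s) ->
  exists2 v, uniq (v :: vs) & search leaf (dists (v :: vs)) s.
Proof.
move=> Uvs /(searchP Uvs)[ok all_rows].
have /and5P[] := ok; rewrite size_dists => i_lt j_lt ij d_gt1 no_mid.
case: vs => // u0 vs0 in Uvs all_rows i_lt j_lt d_gt1 no_mid {ok} *.
move: (u0 :: vs0) => vs in Uvs all_rows i_lt j_lt d_gt1 no_mid *.
have dE := entry_dists connG u0 (vs := vs).
rewrite dE // in d_gt1 no_mid *.
have [v vi vj] := geodesic_step connG (ltnW d_gt1).
have v_notin : v \notin vs.
  apply: contra no_mid => v_in; apply/hasP; exists (index v vs).
    by rewrite mem_iota index_mem.
  have neq k : 0 < dist v (nth u0 vs k) -> k != index v vs.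
    by apply: contraTneq => ->; rewrite nth_index // lt0n dist_eq0 // eqxx.
  rewrite !dE ?index_mem ?nth_index //.
  - by rewrite (dist_sym connG) vi vj !eqxx.
  - by rewrite eq_sym neq // vj -subn1 subn_gt0.
  - by rewrite neq // vi.
exists v; first by rewrite /= v_notin.
apply: all_rows; apply: mem_new_rows => //.
  by move=> u u_in; apply: dist_le_top vi u_in; apply: mem_nth.
rewrite all2E size_mkseq size_map size_dists eqxx /=.
apply/(all_nthP (fun=> true, 0)) => k.
rewrite size_zip size_mkseq size_map size_dists minnn => k_lt.
rewrite nth_zip ?size_mkseq ?size_map ?size_dists //= nth_mkseq ?size_dists //.
rewrite (nth_map u0) //; case: eqP => [->|_]; first by rewrite vi.
by case: eqP => [->|//]; rewrite vj dE.
Qed.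

End Search.

(** * Forbidden induced subgraphs *)

Lemma free_ofP (G H : sgraph) :
    (forall g : H -> G, injective g ->
       (forall x y, adj (g x) (g y) = adj x y) -> False) ->
  free_of G H.
Proof.
move=> noH S [h [h' hK h'K] adjh]; apply: (noH (fun x => val (h' x))) => [x y|x y].
  by move/val_inj/(can_inj h'K).
by rewrite -[in RHS](h'K x) -[in RHS](h'K y) adjh.
Qed.

Lemma Lambda2_embedding_proper (G H : sgraph) (g : H -> G) :
  2 < #|H| -> injective g -> Lambda G 2 -> ~ @distance_ideal G 3 1%R.
Proof. by move=> H3 /leq_card H_le; apply: Lambda2_proper; apply: leq_trans H_le. Qed.

Definition edge_rel (s : seq (nat * nat)) : rel nat :=
  fun i j => ((i, j) \in s) || ((j, i) \in s).

(** No metric survives on the graph with vertices 0, ..., n - 1 and edges s,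
    when its vertices are added in the given order and are followed by vertices
    on geodesics between the pairs of positions in [extra].  Positions count
    from the vertex added last. *)
Definition refuted n (s : seq (nat * nat)) (order : seq nat) (extra : seq (nat * nat)) :=
  [&& 2 < n, all (gtn n) order, uniq order &
      search pred0 [::]
        (attach_steps (edge_rel s) [::] order ++ [seq Between b.1 b.2 | b <- extra])].

Lemma refuted_free (G : sgraph) n s order extra :
  Lambda G 2 -> refuted n s order extra -> free_of G (edge_graph n s).
Proof.
case: n => // n LG /and4P[n_gt2 /allP lt_n Uo search_s]; apply: free_ofP => g injg adjg.
have [connG _] := LG.
have := Lambda2_embedding_proper _ injg LG; rewrite card_ord => /(_ n_gt2) proper3.
pose f i := g (inord i).
have [i j /lt_n i_lt /lt_n j_lt|i j /lt_n i_lt /lt_n j_lt ij|] :=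
  search_embedding (f := f) connG proper3 Uo _ _ search_s.
- by rewrite (inj_eq injg) -val_eqE /= !inordK.
- by rewrite adjg /= /edge_adj -val_eqE /= !inordK // ij.
elim: extra (map f _) {search_s} => [|b extra IH] vs Uvs.
  by move/(search_nil connG proper3 Uvs).
by case/(search_between connG proper3 Uvs) => v /IH.
Qed.

(** * Odd holes *)

Definition path_rel : rel nat := fun i j => (j == i.+1) || (i == j.+1).

(** Paths are not excluded, since a bipartite graph has rank 2 modulo 2; but
    characteristic 2 is the only one that a path on six vertices leaves. *)
Lemma induced_P6 (G : sgraph) (f : nat -> G) :
    connected G -> ~ @distance_ideal G 3 1%R ->
    {in gtn 6 &, forall i j, (f i == f j) = (i == j)} ->
    {in gtn 6 &, forall i j, i != j -> adj (f i) (f j) = path_rel i j} ->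
  @distance_ideal G 3 4%:R%R /\ dist (f 3) (f 0) = 3.
Proof.
(* The newest vertex comes first, so f 3 and f 0 have positions 2 and 5. *)
move=> connG proper3 injf adjf; pose leaf M := (obstruction M %| 4) && (entry M 2 5 == 3).
have search6 : search leaf [::] (attach_steps path_rel [::] (iota 0 6) ++ [::]).
  by vm_compute.
have [i j||Uf] := search_embedding (f := f) connG proper3 (iota_uniq 0 6) _ _ search6.
- by rewrite !mem_iota; apply: injf.
- by move=> i j; rewrite !mem_iota; apply: adjf.
case/(search_nil connG proper3 Uf)/andP => ob4.
rewrite (@entry_dists _ connG (f 0) (map f (rev (iota 0 6))) 2 5 isT isT isT) => /eqP d30.
split; last exact: d30.
move: ob4 (obstruction_sound connG Uf); move: (obstruction _) => n /dvdnP[q ->] In.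
by rewrite natrM; apply: ideal_genMl.
Qed.

Lemma odd_cycle_free (G : sgraph) m :
  Lambda G 2 -> odd m -> 7 <= m -> free_of G (cycle_graph m).
Proof.
case: m => // m LG odd_m m_ge7; apply: free_ofP => c injc adjc.
have [connG _] := LG.
have m_gt2 : 2 < m.+1 by lia.
have := Lambda2_embedding_proper _ injc LG; rewrite card_ord => /(_ m_gt2) proper3.
pose w i : G := c (inord (i %% m.+1)).
have wE i j : (w i == w j) = (i == j %[mod m.+1]).
  by rewrite (inj_eq injc) -val_eqE /= !inordK ?ltn_pmod.
have adjw i j : adj (w i) (w j) = (i != j %[mod m.+1]) &&
    ((j == i.+1 %[mod m.+1]) || (i == j.+1 %[mod m.+1])).
  rewrite adjc /= /cycle_adj -val_eqE /= !inordK ?ltn_pmod //.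
  by rewrite -!(addn1 (_ %% _)) !modnDml !addn1.
have wDE i k l : k < m.+1 -> l < m.+1 -> (w (i + k) == w (i + l)) = (k == l).
  by move=> k_lt l_lt; rewrite wE eqn_modDl !modn_small.
have adjwD i k l : k < m -> l < m -> k != l ->
    adj (w (i + k)) (w (i + l)) = path_rel k l.
  move=> k_lt l_lt kl.
  by rewrite adjw -!addnS !eqn_modDl !modn_small // 1?ltnW // kl.
have P6 i : @distance_ideal G 3 4%:R%R /\ dist (w (i + 3)) (w (i + 0)) = 3.
  apply: (induced_P6 (f := fun k => w (i + k))) => // k l; rewrite !inE => k_lt l_lt.
    by apply: wDE; lia.
  by apply: adjwD; lia.
have d1 i : dist (w i) (w i.+1) = 1.
  by apply/eqP; rewrite dist_eq1 // -[i in w i]addn0 -addn1 adjwD //; lia.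
have d2 i : dist (w i) (w i.+2) = 2.
  apply/eqP; rewrite eqn_leq; apply/andP; split.
    by apply: leq_trans (dist_triangle connG _ (w i.+1) _) _; rewrite !d1.
  have := dist_eq0 connG (w (i + 0)) (w (i + 2)).
  have := dist_eq1 connG (w (i + 0)) (w (i + 2)).
  rewrite wDE ?adjwD ?addn0 ?addn2 //; try lia.
  by rewrite /path_rel /=; case: dist => [|[]].
have d3 i : dist (w i) (w (i + 3)) = 3.
  by have [_] := P6 i; rewrite addn0 dist_sym.
have parity j : 0 < j -> j + 4 < m.+1 ->
    odd (dist (w (j + 4)) (w 0)) = odd (dist (w j) (w 0)).
  move=> j_gt0 j_lt.
  have neq k l : k < m.+1 -> l < m.+1 -> k != l -> w k != w l.
    by move=> k_lt l_lt kl; rewrite wE !modn_small.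
  have uniq_w s : uniq s -> all (gtn m.+1) s -> uniq (map w s).
    move=> Us /allP s_lt; rewrite map_inj_in_uniq // => k l /s_lt k_lt /s_lt l_lt.
    by apply: contra_eq; apply: neq.
  have Ur : uniq (map w [:: j; j.+1; j + 4]) by apply: uniq_w; rewrite /= ?inE; lia.
  have Uc : uniq (map w [:: j.+2; j + 3; 0]) by apply: uniq_w; rewrite /= ?inE; lia.
  have := det3_in_ideal Ur Uc; rewrite /det3 !dentry_neq; try (apply: neq; lia).
  rewrite d2 d3 d1 (_ : dist (w j.+1) (w (j + 3)) = 2); last by rewrite addn3 d2.
  rewrite (_ : dist (w (j + 4)) (w (j + 3)) = 1); last first.
    by rewrite (dist_sym connG) addn4 addn3 d1.
  rewrite (_ : dist (w (j + 4)) (w j.+2) = 2); last by rewrite (dist_sym connG) addn4 d2.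
  move: (dist _ (w 0)) (dist _ (w 0)) (dist _ (w 0)) => x y z I3.
  have [I4 _] := P6 0.
  (* The minor equals z + 4 y - 3 x. *)
  have {I3} Ixz : @distance_ideal G 3 (x + z)%:R%R.
    have := ideal_genD I3 (ideal_genMl (x%:R - y%:R)%R I4).
    by rewrite natrD; congr (ideal_gen _ _); ring.
  have [//|odd_xz] := eqVneq (odd z) (odd x); case: proper3.
  have := ideal_gen_gcd (m := 4) (n := Posz (x + z)) I4 Ixz.
  rewrite (eqP (_ : coprime 4 (x + z))) // (@coprime_pexpl 2 2) // coprime2n oddD.
  by case: (odd x) (odd z) odd_xz => [] [].
have even_dist k : k * 4 + 2 < m.+1 -> ~~ odd (dist (w (k * 4 + 2)) (w 0)).
  elim: k => [_|k IH k_lt]; first by rewrite (dist_sym connG) d2.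
  rewrite (_ : k.+1 * 4 + 2 = k * 4 + 2 + 4); last lia.
  by rewrite parity ?IH //; lia.
have [q mE] : exists q, m.+1 = q * 4 + 3 \/ m.+1 = q.+1 * 4 + 1.
  by exists ((m.+1 - 3) %/ 4); lia.
have w_m : w m.+1 = w 0 by rewrite /w modnn mod0n.
have /even_dist : q * 4 + 2 < m.+1 by lia.
rewrite -w_m; case: mE => mE.
  by rewrite (_ : m.+1 = (q * 4 + 2).+1) ?d1 //; lia.
by rewrite (_ : m.+1 = q * 4 + 2 + 3) ?d3 //; lia.
Qed.

(** * Graphs with at most two trivial distance ideals *)

Theorem theorem23 (G : sgraph) (hG : Lambda G 2) :
  (forall H : sgraph, List.In H family_F -> free_of G H) /\
  (forall m : nat, odd m -> 7 <= m -> free_of G (cycle_graph m)).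
Proof.
split=> [H | m]; last exact: odd_cycle_free.
have free n s order extra := @refuted_free G n s order extra hG.
(* In each order every vertex but the first has an earlier neighbour.  With
   order6 the positions 0 and 1 are the vertices 0 and 1; once a vertex w has
   been added between them, the positions 0, 2, 3, 4 are w and the vertices 1,
   2, 4. *)
pose down n := rev (iota 0 n); pose order6 := [:: 5; 3; 4; 2; 1; 0].
case=> [<-|]; first by apply: (free _ _ (down 5) [::]); vm_compute.
case=> [<-|]; first by apply: (free _ _ (down 5) [::]); vm_compute.
case=> [<-|]; first by apply: (free _ _ (down 5) [::]); vm_compute.
case=> [<-|]; first by apply: (free _ _ (down 5) [::]); vm_compute.
case=> [<-|]; first by apply: (free _ _ (down 5) [::]); vm_compute.
case=> [<-|]; first by apply: (free _ _ (down 6) [::]); vm_compute.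
case=> [<-|]; first by apply: (free _ _ (down 6) [::]); vm_compute.
case=> [<-|]; first by apply: (free _ _ order6 [:: (0, 1); (4, 2)]); vm_compute.
case=> [<-|]; first by apply: (free _ _ (down 6) [::]); vm_compute.
case=> [<-|]; first by apply: (free _ _ (down 6) [::]); vm_compute.
case=> [<-|]; first by apply: (free _ _ order6 [::]); vm_compute.
case=> [<-|]; first by apply: (free _ _ order6 [:: (0, 1); (0, 3)]); vm_compute.
case=> [<-|]; first by apply: (free _ _ order6 [::]); vm_compute.
case=> [<-|]; first by apply: (free _ _ order6 [::]); vm_compute.
case=> [<-|]; first by apply: (free _ _ (down 6) [::]); vm_compute.
by case=> [<-|[]]; apply: (free _ _ (down 7) [::]); vm_compute.
Qed.
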